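(* Let $k$ be a field of characteristic not $2$ with separable closure $k^s$, let $W$ be an $n$-dimensional $k$-vector space, $G=\mathrm{SL}(W)$, and $V=\mathrm{Sym}_2W^*\oplus\mathrm{Sym}_2W^*$. Let $f(x,y)=f_0x^n+f_1x^{n-1}y+\cdots+f_ny^n$ be a binary form of degree $n$ over $k^s$ with $f_0\neq0$ and $\Delta(f)\neq0$. Then there exist vectors $(A,B)\in V(k^s)$ with invariant binary form $f(x,y)$, all such vectors lie in a single $G(k^s)$-orbit, this orbit is closed, and the stabilizer in $G(k^s)$ of any vector in the orbit is an elementary abelian $2$-group of order $2^{n-1}$.
   Context: $\mathrm{Sym}_2W^*$ is the space of symmetric bilinear forms on $W$, with $G$ acting by $(g\cdot A)(w,w')=A(gw,gw')$ (and diagonally on $V$). Fix a basis $e$ of $\wedge^nW$. The discriminant of a symmetric bilinear form $A$ is $\mathrm{disc}(A)=(-1)^{n(n-1)/2}\det(A(w_i,w_j))$ for any basis $w_1,\dots,w_n$ of $W$ with $w_1\wedge\cdots\wedge w_n=e$. The invariant binary form of $(A,B)\in V$ is $f(x,y)=\mathrm{disc}(xA-yB)$. For a binary form $f(x,y)=\prod_i(\alpha_ix-\beta_iy)$ over an algebraic closure, $\Delta(f)=\prod_{i<j}(\alpha_i\beta_j-\alpha_j\beta_i)^2$. *)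

(* Defs.v *)
From HB Require Import structures.
From mathcomp Require Export all_boot all_order all_fingroup all_algebra.
From mathcomp Require Export all_solvable all_field.
From mathcomp.multinomials Require Export mpoly.

Set Implicit Arguments.
Unset Strict Implicit.
Unset Printing Implicit Defensive.

Import GRing.Theory.
Local Open Scope ring_scope.

Definition separable_closure (k ks : fieldType) (iota : {rmorphism k -> ks}) :=
  (forall x : ks, exists2 p : {poly k},
     separable_poly p & root (map_poly iota p) x) /\
  (forall q : {poly ks}, separable_poly q -> (1 < size q)%N ->
     exists x, root q x).

Definition algebraic_closure (K : fieldType) (Kbar : closedFieldType)
    (j : {rmorphism K -> Kbar}) :=
  forall x : Kbar, algebraicOver j x.

(* b : W -> WK exhibits WK as the extension of scalars K \otimes_k W. *)
Definition extension_of_scalars (k K : fieldType) (iota : {rmorphism k -> K})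
    (W : vectType k) (WK : vectType K) (b : {linear W -> WK | iota \; *:%R}) :=
  forall (U : lmodType K) (h : {linear W -> U | iota \; *:%R}),
    exists2 hK : {linear WK -> U},
      forall w, hK (b w) = h w &
      forall hK' : {linear WK -> U}, (forall w, hK' (b w) = h w) -> hK' =1 hK.

Section ExteriorPower.

Variables (k : fieldType) (n : nat) (W : vectType k).

Definition set_tnth (w : n.-tuple W) (i : 'I_n) (u : W) : n.-tuple W :=
  [tuple if l == i then u else tnth w l | l < n].

Definition multilinear (U : lmodType k) (m : n.-tuple W -> U) :=
  forall (w : n.-tuple W) (i : 'I_n) (a : k) (u v : W),
    m (set_tnth w i (a *: u + v)) =
    a *: m (set_tnth w i u) + m (set_tnth w i v).

Definition alternating (U : lmodType k) (m : n.-tuple W -> U) :=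
  forall (w : n.-tuple W) (i j : 'I_n),
    i != j -> tnth w i = tnth w j -> m w = 0.

(* wedge (w_1, .., w_n) = w_1 /\ .. /\ w_n exhibits L as the n-th exterior
   power of W. *)
Definition exterior_power (L : vectType k) (wedge : n.-tuple W -> L) :=
  [/\ multilinear wedge, alternating wedge &
    forall (U : lmodType k) (m : n.-tuple W -> U),
      multilinear m -> alternating m ->
      exists2 h : {linear L -> U},
        forall w, h (wedge w) = m w &
        forall h' : {linear L -> U}, (forall w, h' (wedge w) = m w) -> h' =1 h].

End ExteriorPower.

Section BinaryForms.

Variable R : comNzRingType.

Definition bvarx : {mpoly R[2]} := 'X_(ord0 : 'I_2).
Definition bvary : {mpoly R[2]} := 'X_(ord_max : 'I_2).

Definition binary_form (n : nat) (f : 'I_n.+1 -> R) : {mpoly R[2]} :=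
  \sum_(i < n.+1) f i *: (bvarx ^+ (n - i) * bvary ^+ i).

End BinaryForms.

(* D is the discriminant Delta(f), computed in Kbar from a factorization
   f = \prod_i (alpha_i x - beta_i y). *)
Definition is_Delta (K Kbar : fieldType) (j : {rmorphism K -> Kbar}) (n : nat)
    (f : 'I_n.+1 -> K) (D : Kbar) :=
  exists alpha beta : 'I_n -> Kbar,
    map_mpoly j (binary_form f) =
      \prod_(i < n) (alpha i *: bvarx Kbar - beta i *: bvary Kbar) /\
    D = \prod_(i < n) \prod_(l < n | (i < l)%N)
          (alpha i * beta l - alpha l * beta i) ^+ 2.

Definition disc_mx (R : comNzRingType) (n : nat) (M : 'M[R]_n) : R :=
  (-1) ^+ (n * n.-1)./2 * \det M.

Definition bilin (K : fieldType) (W : vectType K) : vectType K :=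
  'Hom(W, 'Hom(W, K^o)).

Section Representation.

Variables (K : fieldType) (W : vectType K).

Definition Sym2 (A : bilin W) := forall u v : W, A u v = A v u.

Definition inV (v : bilin W * bilin W) := Sym2 v.1 /\ Sym2 v.2.

Definition inSL (g : 'End(W)) :=
  \det (passmx.mxof (vbasis {:W}) (vbasis {:W}) g) = 1.

Definition is_act_form (g : 'End(W)) (A gA : bilin W) :=
  forall u v : W, gA u v = A (g u) (g v).

Definition is_act (g : 'End(W)) (v gv : bilin W * bilin W) :=
  is_act_form g v.1 gv.1 /\ is_act_form g v.2 gv.2.

Definition SL_orbit (v v' : bilin W * bilin W) := exists2 g, inSL g & is_act g v v'.

Definition SL_stabilizer (v : bilin W * bilin W) (g : 'End(W)) :=
  inSL g /\ is_act g v v.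

(* S, a set of endomorphisms, is a group under composition, isomorphic to the
   finite group H. *)
Definition isog_End (S : 'End(W) -> Prop) (gT : finGroupType) (H : {group gT}) :=
  exists phi : gT -> 'End(W),
    [/\ {in H &, injective phi},
        phi 1%g = \1%VF,
        {in H &, forall x y, phi (x * y)%g = (phi x \o phi y)%VF} &
        forall g, S g <-> exists2 x, x \in H & phi x = g].

Definition elementary_abelian_of_order (p m : nat) (S : 'End(W) -> Prop) :=
  exists (gT : finGroupType) (H : {group gT}),
    [/\ isog_End S H, (p.-abelem H)%g & #|H| = m].

End Representation.

Section Zariski.

Variables (K : fieldType) (U : vectType K).

Definition polynomial_function (g : U -> K) :=
  exists (m : nat) (l : 'I_m -> 'Hom(U, K^o)) (p : {mpoly K[m]}),
    forall u, g u = p.@[fun i => l i u].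

Definition zariski_closed_in (X S : U -> Prop) :=
  exists F : (U -> K) -> Prop,
    (forall g, F g -> polynomial_function g) /\
    (forall u, S u <-> X u /\ forall g, F g -> g u = 0).

End Zariski.

(* F(x, y) = disc(xA - yB) for v = (A, B), the discriminant being normalized by
   the basis e of the top exterior power of the k-space W. *)
Definition has_invariant_form (k K : fieldType) (iota : {rmorphism k -> K})
    (n : nat) (W : vectType k) (L : vectType k) (wedge : n.-tuple W -> L) (e : L)
    (WK : vectType K) (b : {linear W -> WK | iota \; *:%R})
    (v : bilin WK * bilin WK) (F : {mpoly K[2]}) :=
  forall w : n.-tuple W, basis_of {:W} w -> wedge w = e ->
    F = disc_mx (\matrix_(i < n, l < n)
          ((v.1 (b (tnth w i)) (b (tnth w l)) : K) *: bvarx K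
           - (v.2 (b (tnth w i)) (b (tnth w l)) : K) *: bvary K)).

(* Main.v *)
From HB Require Import structures.
Require Import Defs.

Import GRing.Theory.
Local Open Scope ring_scope.

Set Implicit Arguments.
Unset Strict Implicit.
Unset Printing Implicit Defensive.

(** Since [Delta f] and [f_0] are nonzero and [ks] is separably closed, the form
    splits as [f = f_0 \prod_i (x - lam_i y)] with distinct [lam_i] in [ks].
    Let [d] be the determinant of [A] prescribed by [f_0].  If [A] and [B] are
    symmetric, [det A = d] and [det (lam_i A - B) = 0] for all [i], then
    eigenvectors of [A^-1 B] for distinct eigenvalues are orthogonal for both
    forms, and after rescaling them by square roots the pair [(A, B)] becomes
    [(diag (d, 1, .., 1), diag (lam_0 d, lam_1, ..))] in a basis of determinant
    [1].  So these [n + 1] polynomial equations cut out exactly the orbit, which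
    is therefore closed and consists of all pairs with invariant form [f].  A
    stabilizer of the diagonal pair commutes with [diag lam], hence is a
    diagonal matrix of signs with product [1].

    Endomorphisms are written as matrices acting on rows of coordinates, so that
    [g] acts on Gram matrices by [a |-> g a g^T]. *)

(** * Simultaneous diagonalization of two symmetric matrices *)

Section Pencils.

Variable K : fieldType.

(** Eigenvectors for distinct eigenvalues are independent: the rows of [u] are left eigenvectors of
    [b a^-1] with eigenvalues [lam i]. *)
Lemma eigenrows_unitmx n (a b u : 'M[K]_n) (lam : 'I_n -> K) :
    a \in unitmx -> injective lam -> (forall i, row i u != 0) ->
    u *m b = diag_mx (\row_i lam i) *m (u *m a) ->
  u \in unitmx.
Proof.
move=> a_unit lam_inj u_nz ub; set l := diag_mx _ in ub.
rewrite unitmxE unitfE; apply/negP => /det0P[c c_nz cu0].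
(* If c u = 0, all c l^k u vanish; inverting the Vandermonde matrix of lam
   isolates the terms c_i u_i. *)
pose cl k := c *m iter k (mulmx l) 1%:M.
have clS k : cl k.+1 = cl k *m l.
  rewrite /cl -mulmxA; congr (_ *m _); elim: k => [|k IHk] /=.
    by rewrite mul1mx mulmx1.
  by rewrite -mulmxA -IHk.
have cl_u k : cl k *m u = 0.
  elim: k => [|k IHk]; first by rewrite /cl /= mulmx1.
  rewrite clS -mulmxA -[l *m u](mulmxK a_unit) -!mulmxA (mulmxA u) mulmxA.
  by rewrite (mulmxA l) -ub !mulmxA IHk !mul0mx.
have clE k j : cl k 0 j = lam j ^+ k * c 0 j.
  elim: k => [|k IHk]; first by rewrite /cl mulmx1 mul1r.
  by rewrite clS mul_mx_diag mxE IHk mxE mulrAC -exprSr.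
pose V := Vandermonde n (\row_i lam i).
have V_unit : V \in unitmx.
  rewrite unitmxE unitfE det_Vandermonde; apply/prodf_neq0 => i _.
  apply/prodf_neq0 => j ij; rewrite !mxE subr_eq0 (inj_eq lam_inj).
  by apply: contraTneq ij => ->; rewrite ltnn.
have cu : diag_mx c *m u = 0.
  rewrite -[LHS](mulKmx V_unit); apply: (canLR (mulKmx V_unit)).
  rewrite mulmx0 mulmxA; apply/row_matrixP => k; rewrite row0 row_mul.
  rewrite -[RHS](cl_u k); congr (_ *m _).
  by apply/rowP => j; rewrite clE mul_mx_diag !mxE.
case/rV0Pn: c_nz => i ci; case/negP: (u_nz i); apply/eqP/rowP => j.
move/matrixP/(_ i j)/eqP: cu; rewrite mul_diag_mx !mxE mulf_eq0 (negPf ci) /=.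
by move/eqP.
Qed.

(** Row [i] of [u] is a kernel vector of [lam i *: a - b]; symmetry makes these rows orthogonal for
    [a], hence also for [b]. *)
Lemma symmetric_pencil_diag n (a b : 'M[K]_n) (lam : 'I_n -> K) :
    a^T = a -> b^T = b -> a \in unitmx -> injective lam ->
    (forall i, \det (lam i *: a - b) = 0) ->
  exists (u : 'M_n) (d : 'rV_n),
    [/\ u \in unitmx, u *m a *m u^T = diag_mx d
      & u *m b *m u^T = diag_mx (\row_i (lam i * d 0 i))].
Proof.
move=> aT bT a_unit lam_inj det0.
have /fin_all_exists[r rP] i :
    exists r : 'rV_n, r != 0 /\ r *m b = lam i *: (r *m a).
  have /eqP/det0P[r r_nz r0] := det0 i; exists r; split=> //.
  by apply/esym/eqP; rewrite -subr_eq0 scalemxAr -mulmxBr r0.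
pose u := \matrix_i r i.
have ub : u *m b = diag_mx (\row_i lam i) *m (u *m a).
  apply/row_matrixP => i; rewrite row_mul rowK (rP i).2 -[r i](rowK r).
  rewrite -row_mul -/u; move: (u *m a) => m.
  by apply/rowP => j; rewrite mul_diag_mx !mxE.
have u_unit : u \in unitmx.
  by apply: (eigenrows_unitmx a_unit lam_inj _ ub) => i; rewrite rowK (rP i).1.
have [s sdef] : {s | s = u *m a *m u^T} by eexists.
have sT : s^T = s by rewrite sdef !trmx_mul trmxK aT mulmxA.
have ubE : u *m b *m u^T = diag_mx (\row_i lam i) *m s.
  by rewrite ub sdef !mulmxA.
(* Both [s] and [diag lam * s] are symmetric, so [(lam i - lam j) * s i j = 0]. *)
have s_diag i j : i != j -> s i j = 0.
  move=> ij; have: (u *m b *m u^T)^T = u *m b *m u^T.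
    by rewrite !trmx_mul trmxK bT mulmxA.
  move/matrixP/(_ i j); rewrite mxE ubE mul_diag_mx !mxE -[in s j i]sT mxE.
  move/eqP; rewrite -subr_eq0 -mulrBl mulf_eq0 subr_eq0 (inj_eq lam_inj).
  by rewrite eq_sym (negPf ij) => /eqP.
have sE : s = diag_mx (\row_i s i i).
  by apply/matrixP=> i j; rewrite !mxE; case: eqVneq => [->|/s_diag].
exists u, (\row_i s i i); split; rewrite -?sdef // ubE {1}sE mulmx_diag.
by congr diag_mx; apply/rowP => i; rewrite !mxE.
Qed.

(** Besides the diagonal of the normal form of [A], this row of product [d] also serves to prescribe
    the determinant of a change of basis. *)
Definition one_tail n (d : K) : 'rV[K]_n.+1 :=
  \row_i (if i == ord0 then d else 1).

Definition weighted_diag n (d : K) (lam : 'I_n.+1 -> K) : 'M[K]_n.+1 :=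
  diag_mx (\row_i (lam i * one_tail n d 0 i)).

Lemma prod_one_tail n (d : K) : \prod_i one_tail n d 0 i = d.
Proof.
by rewrite big_ord_recl mxE eqxx big1 ?mulr1 // => i _; rewrite mxE.
Qed.

Lemma symmetric_pencil_normal_form n (a b : 'M[K]_n.+1) (lam : 'I_n.+1 -> K) :
    (forall x : K, exists y, y ^+ 2 = x) ->
    a^T = a -> b^T = b -> \det a != 0 -> injective lam ->
    (forall i, \det (lam i *: a - b) = 0) ->
  exists g : 'M_n.+1, [/\ \det g = 1,
     a = g *m diag_mx (one_tail n (\det a)) *m g^T
   & b = g *m weighted_diag (\det a) lam *m g^T].
Proof.
move=> sqrtK aT bT a_nz lam_inj det0; set d := \det a in a_nz *.
have a_unit : a \in unitmx by rewrite unitmxE unitfE.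
have [u [t [u_unit ut ult]]] :=
  symmetric_pencil_diag aT bT a_unit lam_inj det0.
have t_nz i : t 0 i != 0.
  have: \det (diag_mx t) != 0.
    by rewrite -ut !det_mulmx det_tr !mulf_neq0 // -unitfE -unitmxE.
  by rewrite det_diag => /prodf_neq0; apply.
(* Scaling row [i] of [u] by [s i] multiplies the diagonal entry [t 0 i] by [s i ^+ 2], which gives
   the entry of [one_tail n d]. *)
have /fin_all_exists[s sP] i := sqrtK (one_tail n d 0 i / t 0 i).
have sE i : s i * s i * t 0 i = one_tail n d 0 i by rewrite -expr2 sP divfK.
pose p := diag_mx (\row_i s i) *m u.
have pP (m : 'M_n.+1) (x : 'rV_n.+1) : u *m m *m u^T = diag_mx x ->
    p *m m *m p^T = diag_mx (\row_i (s i * s i * x 0 i)).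
  move=> um; rewrite trmx_mul tr_diag_mx !mulmxA -[p *m m]mulmxA.
  rewrite -!mulmxA [u *m _]mulmxA [_ *m (u^T *m _)]mulmxA um !mulmx_diag.
  by congr diag_mx; apply/rowP=> i; rewrite !mxE mulrA mulrAC.
have pa : p *m a *m p^T = diag_mx (one_tail n d).
  by rewrite (pP _ _ ut); congr diag_mx; apply/rowP=> i; rewrite !mxE sE mxE.
have pb : p *m b *m p^T = weighted_diag d lam.
  rewrite (pP _ _ ult); congr diag_mx; apply/rowP=> i.
  by rewrite [LHS]mxE [in LHS]mxE mulrCA sE [RHS]mxE.
(* The matrices [a] and [diag_mx (one_tail n d)] both have determinant [d], so [(det p)^2 d = d]. *)
have det_p : \det p * \det p = 1.
  apply: (mulIf a_nz); rewrite mul1r -[RHS](prod_one_tail n) -det_diag -pa.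
  by rewrite (det_mulmx _ p^T) (det_mulmx p) det_tr mulrAC.
clearbody p.
(* Rescaling the first row by det p = 1 or -1 makes the determinant 1 and
   does not affect a diagonal Gram matrix. *)
pose e := diag_mx (one_tail n (\det p)); pose q := e *m p.
have eE (x : 'rV_n.+1) : e *m diag_mx x *m e^T = diag_mx x.
  rewrite tr_diag_mx !mulmx_diag; congr diag_mx; apply/rowP => i; rewrite !mxE.
  by case: ifP => _; rewrite ?mul1r ?mulr1 // mulrAC det_p mul1r.
have qE (m : 'M_n.+1) : q *m m *m q^T = e *m (p *m m *m p^T) *m e^T.
  by rewrite trmx_mul !mulmxA.
have det_q : \det q = 1 by rewrite det_mulmx det_diag prod_one_tail.
clearbody q.
have q_unit : q \in unitmx by rewrite unitmxE det_q unitr1.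
exists (invmx q); split; first by rewrite det_inv det_q invr1.
  rewrite -(eE (one_tail n d)) -pa -qE trmx_inv -!mulmxA mulmxV ?unitmx_tr //.
  by rewrite mulmx1 mulKmx.
rewrite /weighted_diag -(eE (\row__ _)) -/(weighted_diag d lam) -pb -qE.
by rewrite trmx_inv -!mulmxA mulmxV ?unitmx_tr // mulmx1 mulKmx.
Qed.

End Pencils.

(** * The stabilizer of the normal form and vectors of signs *)

Section Signs.

Variable K : fieldType.

(** Eliminating [s^T] between the two equations shows that [s] commutes with [diag lam]. Distinct
    [lam i] make [s] diagonal, and the first equation then forces its entries to square to 1. *)
Lemma normal_form_stabilizer n (d : K) (lam : 'I_n.+1 -> K) (s : 'M[K]_n.+1) :
    d != 0 -> injective lam ->
    s *m diag_mx (one_tail n d) *m s^T = diag_mx (one_tail n d) ->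
    s *m weighted_diag d lam *m s^T = weighted_diag d lam ->
  exists2 t : 'rV_n.+1, s = diag_mx t & forall i, t 0 i ^+ 2 = 1.
Proof.
move=> d_nz lam_inj; set D := diag_mx (one_tail n d) => sD sL.
have D_nz i : one_tail n d 0 i != 0.
  by rewrite mxE; case: ifP; rewrite ?oner_eq0.
have D_unit : D \in unitmx.
  by rewrite unitmxE unitfE det_diag; apply/prodf_neq0 => i _.
have WE : weighted_diag d lam = diag_mx (\row_i lam i) *m D.
  by rewrite mulmx_diag; congr diag_mx; apply/rowP => i; rewrite !mxE.
have sT_unit : s^T \in unitmx.
  by move: D_unit; rewrite -{1}sD unitmx_mul => /andP[].
(* Multiplied on the right by [D s^T], both sides become [diag lam * D]. *)
have sl : s *m diag_mx (\row_i lam i) = diag_mx (\row_i lam i) *m s.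
  apply: (can_inj (mulmxK D_unit)); apply: (can_inj (mulmxK sT_unit)).
  by rewrite -[in LHS](mulmxA s) -WE sL WE -{1}sD !mulmxA.
have s_diag i j : i != j -> s i j = 0.
  move=> ij; move/matrixP/(_ i j): sl; rewrite mul_mx_diag mul_diag_mx !mxE.
  move/eqP; rewrite mulrC -subr_eq0 -mulrBl mulf_eq0 subr_eq0 (inj_eq lam_inj).
  by rewrite eq_sym (negPf ij) => /eqP.
have sE : s = diag_mx (\row_i s i i).
  by apply/matrixP=> i j; rewrite !mxE; case: eqVneq => [->|/s_diag].
exists (\row_i s i i) => // i; apply: (mulIf (D_nz i)); rewrite mul1r expr2.
move/matrixP/(_ i i): sD; rewrite {1 2}sE tr_diag_mx !mulmx_diag.
by rewrite !mxE eqxx !mulr1n mulrAC.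
Qed.

(** A parametrization of the sign vectors of product 1: all signs but the first are free, and the
    first is their product. *)
Definition sign_row n (x : 'rV['F_2]_n) : 'rV[K]_n.+1 :=
  \row_i (if unlift ord0 i is Some k then (-1) ^+ x 0 k
          else \prod_k (-1) ^+ x 0 k).

Lemma sign_row0 n (x : 'rV['F_2]_n) :
  sign_row x 0 ord0 = \prod_k (-1) ^+ x 0 k.
Proof. by rewrite mxE unlift_none. Qed.

Lemma sign_row_lift n (x : 'rV['F_2]_n) k :
  sign_row x 0 (lift ord0 k) = (-1) ^+ x 0 k.
Proof. by rewrite mxE liftK. Qed.

Lemma prod_sign_row n (x : 'rV['F_2]_n) : \prod_i sign_row x 0 i = 1.
Proof.
rewrite big_ord_recl sign_row0 -big_split big1 //= => k _.
by rewrite sign_row_lift -expr2 sqrr_sign.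
Qed.

Lemma sign_rowD n (x y : 'rV['F_2]_n) i :
  sign_row (x + y) 0 i = sign_row x 0 i * sign_row y 0 i.
Proof.
(* Addition in ['F_2] reduces modulo 2, and a power of -1 depends only on the parity of the
   exponent. *)
have sD (u v : 'F_2) : (-1) ^+ (u + v)%R = (-1) ^+ u * (-1) ^+ v :> K.
  by rewrite -exprD -[RHS]signr_odd -[LHS]signr_odd /= modn2 oddb.
case: (unliftP ord0 i) => [k|] ->; last first.
  by rewrite !sign_row0 -big_split; apply: eq_bigr => k _; rewrite mxE sD.
by rewrite !sign_row_lift mxE sD.
Qed.

Lemma sign_row_sqr n (x : 'rV['F_2]_n) i : sign_row x 0 i ^+ 2 = 1.
Proof.
rewrite expr2 -sign_rowD; have -> : x + x = 0.
  by apply/rowP => k; rewrite !mxE; apply/val_inj; case: (x 0 k) => -[|[]].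
case: (unliftP ord0 i) => [k|] ->; rewrite ?sign_row_lift ?sign_row0 ?mxE //.
by rewrite big1 // => k _; rewrite mxE.
Qed.

Hypothesis two_nz : 2%:R != 0 :> K.

Lemma one_eqN1 : (1 == -1 :> K) = false.
Proof. by rewrite -addr_eq0 -mulr2n; apply: negbTE. Qed.

Lemma sign_row_inj n : injective (@sign_row n).
Proof.
move=> x y /rowP xy; apply/rowP => k; apply/val_inj.
move: (xy (lift ord0 k)); rewrite !sign_row_lift.
case: (x 0 k) (y 0 k) => [[|[|[]]] // ?] [[|[|[]]] // ?] /= /eqP.
  by rewrite expr0 expr1 one_eqN1.
by rewrite expr0 expr1 eq_sym one_eqN1.
Qed.

Lemma sign_row_surj n (t : 'rV[K]_n.+1) :
    (forall i, t 0 i ^+ 2 = 1) -> \prod_i t 0 i = 1 ->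
  exists x, sign_row x = t.
Proof.
move=> t2 t1; pose x : 'rV['F_2]_n := \row_k (t 0 (lift ord0 k) == -1)%:R.
have xE k : (-1) ^+ x 0 k = t 0 (lift ord0 k).
  rewrite mxE; have /eqP := t2 (lift ord0 k); rewrite sqrf_eq1.
  by case/orP => /eqP ->; rewrite ?one_eqN1 ?eqxx.
exists x; apply/rowP => i; case: (unliftP ord0 i) => [k|] ->.
  by rewrite sign_row_lift xE.
rewrite sign_row0 (eq_bigr _ (fun k _ => xE k)).
(* From [t_0 p = 1] and [t_0^2 = 1], the product [p] of the remaining entries is [t_0]. *)
move: t1; rewrite big_ord_recl => t1; set p := \prod_(_ < _) _ in t1 *.
by rewrite -[p]mul1r -(t2 ord0) expr2 -mulrA t1 mulr1.
Qed.

End Signs.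

(** * Square roots and splitting over a separably closed field *)

Section SeparablyClosed.

Variable K : fieldType.
Hypothesis sepK :
  forall q : {poly K}, separable_poly q -> (1 < size q)%N -> exists x, root q x.

(** For [x != 0] the polynomial [X^2 - x] is separable: its derivative [2X] is a nonzero multiple of
    [X], and 0 is not a root. *)
Lemma sepclosed_sqrt : 2%:R != 0 :> K -> forall x : K, exists y, y ^+ 2 = x.
Proof.
move=> two_nz x; have [->|x_nz] := eqVneq x 0.
  by exists 0; rewrite expr0n.
have [||y] := sepK (q := 'X^2 - x%:P).
- rewrite unlock derivB derivC derivXn subr0 expr1 -scaler_nat.
  rewrite coprimepZr // -['X]subr0 coprimep_XsubC /root !hornerE.
  by rewrite oppr0 expr0n sub0r oppr_eq0.
- by rewrite size_polyDl size_polyXn ?size_polyN ?size_polyC //; case: eqP.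
by rewrite /root !hornerE subr_eq0 => /eqP yx; exists y.
Qed.

(** Roots are split off one at a time; the cofactor of a linear factor in a separable polynomial
    stays separable. *)
Lemma sepclosed_split (p : {poly K}) :
  separable_poly p -> exists rs, p = lead_coef p *: \prod_(z <- rs) ('X - z%:P).
Proof.
have [m] := ubnP (size p); elim: m p => // m IHm p lt_pm sep_p.
have [p_le1|p_gt1] := leqP (size p) 1.
  exists [::]; rewrite big_nil alg_polyC {1}[p]size1_polyC //.
  by rewrite lead_coefE; case: (size p) p_le1 => [|[]].
have [x /factor_theorem[q pE]] := sepK sep_p p_gt1.
have p_nz : p != 0 by rewrite -size_poly_gt0 ltnW.
have q_nz : q != 0 by apply: contraNneq p_nz => q0; rewrite pE q0 mul0r.
have [||rs qE] := IHm q.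
- move: lt_pm; rewrite pE size_Mmonic ?monicXsubC // size_XsubC addn2.
  by rewrite /= ltnS.
- by move: sep_p; rewrite pE separable_root => /andP[].
exists (x :: rs); rewrite big_cons pE lead_coefM lead_coefXsubC mulr1.
by rewrite {1}qE mulrC scalerAr.
Qed.

End SeparablyClosed.

(** * Factorization of binary forms by dehomogenization *)

Lemma map_mpoly_inj n (K L : fieldType) (j : {rmorphism K -> L}) :
  injective (@map_mpoly n K L j).
Proof.
move=> p q /mpolyP pq; apply/mpolyP => m; apply: (fmorph_inj j).
by rewrite -!mcoeff_map_mpoly pq.
Qed.

Lemma map_bvarx (R S : comNzRingType) (j : {rmorphism R -> S}) :
  map_mpoly j (bvarx R) = bvarx S.
Proof. exact: map_mpolyX. Qed.

Lemma map_bvary (R S : comNzRingType) (j : {rmorphism R -> S}) :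
  map_mpoly j (bvary R) = bvary S.
Proof. exact: map_mpolyX. Qed.

Lemma map_binary_form (R S : comNzRingType) (j : {rmorphism R -> S}) n
    (f : 'I_n.+1 -> R) :
  map_mpoly j (binary_form f) = binary_form (j \o f).
Proof.
rewrite /binary_form rmorph_sum; apply: eq_bigr => i _.
by rewrite /= map_mpolyZ rmorphM !rmorphXn /= map_bvarx map_bvary.
Qed.

Definition dehomogenize (R : comNzRingType) : {mpoly R[2]} -> {poly R} :=
  mmap polyC (fun i : 'I_2 => if i == ord0 then 'X else 1).

Lemma dehomogenize_x (R : comNzRingType) : dehomogenize (bvarx R) = 'X.
Proof. by rewrite /dehomogenize mmapX mmap1U eqxx. Qed.

Lemma dehomogenize_y (R : comNzRingType) : dehomogenize (bvary R) = 1.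
Proof. by rewrite /dehomogenize mmapX mmap1U. Qed.

Lemma dehomogenize_form (R : comNzRingType) n (f : 'I_n.+1 -> R) :
  dehomogenize (binary_form f) = \sum_(i < n.+1) f i *: 'X^(n - i).
Proof.
rewrite /dehomogenize /binary_form rmorph_sum; apply: eq_bigr => i _ /=.
rewrite mmapZ rmorphM !rmorphXn /= -/(dehomogenize _) dehomogenize_x.
by rewrite -/(dehomogenize _) dehomogenize_y expr1n mulr1 mul_polyC.
Qed.

Lemma meval10_form (R : comNzRingType) n (f : 'I_n.+1 -> R) :
  (binary_form f).@[fun i => (i == ord0)%:R] = f ord0.
Proof.
rewrite /binary_form rmorph_sum big_ord_recl /= big1 ?addr0 => [|i _] /=.
  by rewrite mevalZ mevalM !rmorphXn /= !mevalXU subn0 expr0 expr1n !mulr1.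
by rewrite mevalZ mevalM !rmorphXn /= !mevalXU expr0n /= !mulr0.
Qed.

(** Over [L] the product of the [alpha i] is [f_0 != 0], so the factors normalize to [x - mu_i y],
    and [D != 0] makes the [mu_i] distinct. Hence [f(X, 1)] is separable, already over [K], where it
    splits; so the [mu_i] come from [K], and the factorization descends along [j]. *)
Lemma binary_form_split (K : fieldType)
    (sepK : forall q : {poly K},
       separable_poly q -> (1 < size q)%N -> exists x, root q x)
    (L : fieldType) (j : {rmorphism K -> L}) n (f : 'I_n.+1 -> K) (D : L) :
    f ord0 != 0 -> is_Delta j f D -> D != 0 ->
  exists2 lam : 'I_n -> K, injective lam &
    binary_form f = f ord0 *: \prod_i (bvarx K - lam i *: bvary K).
Proof.
move=> f0_nz [alpha [beta [fE DE]]] D_nz.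
(* Evaluation at [(1, 0)] extracts the coefficient of [x^n]. *)
have alphaE : \prod_i alpha i = j (f ord0).
  move/(congr1 (meval (fun i => (i == ord0)%:R))): fE.
  rewrite map_binary_form meval10_form rmorph_prod /= => ->.
  by apply: eq_bigr => i _; rewrite mevalB !mevalZ !mevalXU mulr1 mulr0 subr0.
have alpha_nz i : alpha i != 0.
  have: \prod_i alpha i != 0 by rewrite alphaE fmorph_eq0.
  by move/prodf_neq0; apply.
pose mu i := beta i / alpha i.
have mu_lt (i l : 'I_n) : (i < l)%N -> mu i != mu l.
  move=> il; rewrite eqr_div // -subr_eq0 -oppr_eq0 opprB.
  move: D_nz; rewrite DE => /prodf_neq0/(_ i isT)/prodf_neq0/(_ l il).
  by rewrite sqrf_eq0 mulrC [alpha l * _]mulrC.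
have mu_inj : injective mu.
  move=> i l mu_il; apply/val_inj; case: (ltngtP i l) => // /mu_lt.
    by rewrite mu_il eqxx.
  by rewrite mu_il eqxx.
have fmu : map_mpoly j (binary_form f) =
    j (f ord0) *: \prod_i (bvarx L - mu i *: bvary L).
  rewrite fE -alphaE -scaler_prod; apply: eq_bigr => i _.
  by rewrite scalerBr scalerA mulrC divfK.
pose p := dehomogenize (binary_form f).
have pE : map_poly j p =
    j (f ord0) *: \prod_(z <- map mu (enum 'I_n)) ('X - z%:P).
  rewrite big_map big_enum /=.
  have -> : map_poly j p = dehomogenize (map_mpoly j (binary_form f)).
    rewrite map_binary_form /p !dehomogenize_form rmorph_sum; apply: eq_bigr.
    by move=> i _; rewrite /= linearZ /= map_polyXn.
  rewrite fmu /dehomogenize mmapZ rmorph_prod -mul_polyC; congr (_ * _).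
  apply: eq_bigr => i _; rewrite rmorphB /= mmapZ -!/(dehomogenize _).
  by rewrite dehomogenize_x dehomogenize_y mulr1.
have sep_p : separable_poly p.
  rewrite -(separable_map j) pE (eqp_separable (eqp_scale _ _)) ?fmorph_eq0 //.
  by rewrite separable_prod_XsubC map_inj_uniq ?enum_uniq.
have [rs prs] := sepclosed_split sepK sep_p.
(* The splitting [prs] over [K], mapped to [L], shows that every root of [map_poly j p] is the image
   of some element of [rs]. *)
have /fin_all_exists[lam lamE] i : exists l, j l = mu i.
  have: root (map_poly j p) (mu i).
    rewrite pE rootZ ?fmorph_eq0 // root_prod_XsubC map_f //.
    by rewrite mem_enum.
  have p_nz : p != 0 by apply: separable_poly_neq0.
  rewrite prs linearZ /= rootZ ?fmorph_eq0 ?lead_coef_eq0 // rmorph_prod /=.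
  under eq_bigr do rewrite rmorphB /= map_polyX map_polyC /=.
  rewrite -(big_map j predT (fun z => 'X - z%:P)) root_prod_XsubC.
  by case/mapP => l _ ->; exists l.
exists lam; first by move=> i l il; apply: mu_inj; rewrite -!lamE il.
apply: (map_mpoly_inj (j := j)); rewrite fmu map_mpolyZ rmorph_prod /=.
congr (_ *: _); apply: eq_bigr => i _.
by rewrite rmorphB /= map_mpolyZ map_bvarx map_bvary lamE.
Qed.

(** * Bilinear forms and endomorphisms in coordinates *)

Lemma linear_lfun (K : fieldType) (U V : vectType K) (f : U -> V) :
  linear f -> exists F : 'Hom(U, V), F =1 f.
Proof.
move=> lf.
pose F : {linear U -> V} := HB.pack f (GRing.isLinear.Build K U V *:%R f lf).
by exists (linfun F) => u; rewrite lfunE.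
Qed.

Section Coordinates.

Variables (K : fieldType) (W : vectType K) (n : nat).
Implicit Types (X t : n.-tuple W) (A B : bilin W) (g h : 'End(W)).

Definition coords_mx X t : 'M[K]_n := \matrix_(i, j) coord X j (tnth t i).

Definition coord_row X v : 'rV[K]_n := \row_j coord X j v.

Definition gram t A : 'M[K]_n :=
  \matrix_(i, j) (A (tnth t i) (tnth t j) : K).

Definition endmx X g : 'M[K]_n := coords_mx X (map_tuple g X).

Variable X : n.-tuple W.
Hypothesis Xb : basis_of {:W} X.

Lemma coord_tnth v : v = \sum_i coord X i v *: tnth X i.
Proof.
rewrite {1}(coord_basis Xb (memvf v)); apply: eq_bigr => i _.
by rewrite (tnth_nth 0).
Qed.

Lemma coord_tnth_id i j : coord X j (tnth X i) = (i == j)%:R.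
Proof. by rewrite (tnth_nth 0) coord_free ?(basis_free Xb). Qed.

Lemma coords_mx_id : coords_mx X X = 1%:M.
Proof. by apply/matrixP=> i j; rewrite !mxE coord_tnth_id. Qed.

Lemma coords_mx_surj (m : 'M_n) : exists t, coords_mx X t = m.
Proof.
exists [tuple \sum_j m i j *: X`_j | i < n]; apply/matrixP => i j.
by rewrite mxE tnth_mktuple coord_sum_free ?(basis_free Xb).
Qed.

Lemma coords_mx_basis t : \det (coords_mx X t) != 0 -> basis_of {:W} t.
Proof.
move=> t_nz; have dimX : \dim {:W} = n by apply: vector.size_basis Xb.
rewrite basisEfree subvf size_tuple dimX leqnn !andbT.
apply/freeP => c ct0 i; pose r : 'rV_n := \row_i c i.
have r0 : r *m coords_mx X t = 0.
  apply/rowP => j; rewrite !mxE -[RHS](linear0 (coord X j)) -ct0 linear_sum.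
  by apply: eq_bigr => l _; rewrite !mxE linearZ /= (tnth_nth 0).
have t_unit : coords_mx X t \in unitmx by rewrite unitmxE unitfE.
have /rowP/(_ i) : r = 0 by rewrite -[r](mulmxK t_unit) r0 mul0mx.
by rewrite !mxE.
Qed.

Lemma bilin_coords A u v :
  A u v = (coord_row X u *m gram X A *m (coord_row X v)^T) 0 0.
Proof.
rewrite !mxE {1}[u]coord_tnth {1}[v]coord_tnth !linear_sum /=.
apply: eq_bigr => j _; rewrite !mxE linearZ /= sum_lfunE.
rewrite mulrC; congr (_ * _).
by apply: eq_bigr => i _; rewrite linearZ /= scale_lfunE !mxE.
Qed.

Lemma gram_coords t A :
  gram t A = coords_mx X t *m gram X A *m (coords_mx X t)^T.
Proof.
have tE i : coord_row X (tnth t i) = row i (coords_mx X t).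
  by apply/rowP => j; rewrite !mxE.
apply/matrixP => i l; rewrite [LHS]mxE bilin_coords !tE -row_mul tr_row.
by rewrite [LHS]mxE [RHS]mxE; apply: eq_bigr => m _; rewrite [in LHS]mxE !mxE.
Qed.

Lemma basis_lfun (V : vectType K) (z : 'I_n -> V) :
  exists F : 'Hom(W, V), forall i, F (tnth X i) = z i.
Proof.
have [|F FE] := @linear_lfun _ W V (fun v => \sum_i coord X i v *: z i).
  move=> c u v; rewrite scaler_sumr -big_split; apply: eq_bigr => i _ /=.
  by rewrite linearP /= scalerDl scalerA.
exists F => i; rewrite FE (bigD1 i) //= coord_tnth_id eqxx scale1r.
rewrite big1 ?addr0 // => l li.
by rewrite coord_tnth_id eq_sym (negPf li) scale0r.
Qed.

(** As [bilin W] is an iterated ['Hom], values on a basis are prescribed twice: first for each row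
    of [a], then for the map sending basis vectors to these functionals. *)
Lemma gram_surj (a : 'M_n) : exists A, gram X A = a.
Proof.
have /fin_all_exists[c cE] i := basis_lfun (V := K^o) (a i).
have [A AE] := basis_lfun c.
by exists A; apply/matrixP => i j; rewrite mxE AE cE.
Qed.

Lemma Sym2_gram A : Sym2 A <-> (gram X A)^T = gram X A.
Proof.
split=> [sA|sA u v]; first by apply/matrixP => i j; rewrite !mxE sA.
(* Transposing the 1 by 1 matrix of [bilin_coords] exchanges [u] and [v]. *)
have tr00 (m : 'M[K]_1) : m 0 0 = m^T 0 0 by rewrite mxE.
by rewrite !bilin_coords tr00 !trmx_mul trmxK sA mulmxA.
Qed.

Lemma endmxE g i : g (tnth X i) = \sum_j endmx X g i j *: tnth X j.
Proof.
by rewrite [LHS]coord_tnth; apply: eq_bigr => j _; rewrite mxE tnth_map.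
Qed.

Lemma endmx1 : endmx X \1%VF = 1%:M.
Proof.
by apply/matrixP => i j; rewrite !mxE tnth_map lfunE /= coord_tnth_id.
Qed.

(** The order is reversed because matrices act on rows of coordinates from the right. *)
Lemma endmx_comp g h : endmx X (g \o h)%VF = endmx X h *m endmx X g.
Proof.
apply/matrixP => i j; rewrite mxE tnth_map comp_lfunE endmxE !linear_sum !mxE.
apply: eq_bigr => l _ /=; rewrite !linearZ /=; congr (_ * _).
by rewrite [RHS]mxE tnth_map.
Qed.

Lemma endmx_inj : injective (endmx X).
Proof.
move=> g h gh; apply/lfunP => v; rewrite [v]coord_tnth !linear_sum.
by apply: eq_bigr => i _; rewrite !linearZ /= !endmxE gh.
Qed.

Lemma endmx_surj (m : 'M_n) : exists g, endmx X g = m.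
Proof.
have [t tE] := coords_mx_surj m; have [g gE] := basis_lfun (tnth t).
by exists g; rewrite -tE; apply/matrixP => i j; rewrite !mxE tnth_map gE.
Qed.

Lemma coord_row_endmx g u : coord_row X (g u) = coord_row X u *m endmx X g.
Proof.
apply/rowP => j; rewrite !mxE {1}[u]coord_tnth !linear_sum.
by apply: eq_bigr => i _; rewrite !linearZ !mxE tnth_map.
Qed.

Lemma is_act_formP g A B :
  is_act_form g A B <-> gram X B = endmx X g *m gram X A *m (endmx X g)^T.
Proof.
split=> [BA|gB u v].
  by rewrite -gram_coords; apply/matrixP => i j; rewrite !mxE !tnth_map BA.
by rewrite !bilin_coords gB !coord_row_endmx trmx_mul !mulmxA.
Qed.

End Coordinates.

(** The determinant does not depend on the basis: the two matrices of [g] are conjugate by the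
    matrices of the identity between [X] and [vbasis]. *)
Lemma inSL_endmx (K : fieldType) (W : vectType K) n (X : n.-tuple W) g :
  basis_of {:W} X -> inSL g <-> \det (endmx X g) = 1.
Proof.
move=> Xb; have e : \dim {:W} = n by apply: vector.size_basis Xb.
(* Replacing [n] by the dimension gives [X] and [vbasis {:W}] the same tuple type. *)
case: n / e X Xb => X Xb; set Y := vbasis {:W}.
have Yb : basis_of {:W} Y by apply: vbasisP.
have -> : endmx X g = passmx.mxof X X g.
  apply/matrixP => i j; rewrite !mxE tnth_map (tnth_nth 0) /=.
  by rewrite passmx.vecof_delta.
rewrite /inSL -/Y.
have -> : passmx.mxof Y Y g =
    passmx.mxof Y X \1%VF *m passmx.mxof X X g *m passmx.mxof X Y \1%VF.
  by rewrite -!passmx.mxof_comp // comp_lfun1r comp_lfun1l.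
rewrite !det_mulmx mulrAC -det_mulmx -passmx.mxof_comp // comp_lfun1l.
by rewrite passmx.mxof1 ?(basis_free Yb) // det1 mul1r.
Qed.

(** * Determinants and the top exterior power *)

Section ExteriorTop.

Variables (k : fieldType) (n : nat) (W L : vectType k).
Variable wedge : n.-tuple W -> L.
Hypothesis hL : exterior_power wedge.

(** The determinant in coordinates is multilinear and alternating, so the universal property factors
    it through [wedge]. *)
Lemma exterior_power_det (X : n.-tuple W) :
  exists h : {linear L -> k^o}, forall w, h (wedge w) = \det (coords_mx X w).
Proof.
have [_ _ univ] := hL.
have [||h hE _] := univ k^o (fun w => \det (coords_mx X w)).
- move=> w i a u v; rewrite -[Y in _ = _ + Y]mul1r.
  apply: (determinant_multilinear (i0 := i)).
  + apply/rowP => j; rewrite !mxE !tnth_mktuple eqxx linearP /=.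
    by rewrite mul1r.
  + apply/matrixP => l j; rewrite !mxE !tnth_mktuple.
    by rewrite eq_sym (negPf (neq_lift _ _)).
  + apply/matrixP => l j; rewrite !mxE !tnth_mktuple.
    by rewrite eq_sym (negPf (neq_lift _ _)).
- move=> w i l il wil; apply: (determinant_alternate il) => j.
  by rewrite !mxE wil.
by exists h.
Qed.

Variable e : L.
Hypothesis he : basis_of {:L} [:: e].

(** The determinant depends on [w] only through [wedge w], which equals [wedge X]. *)
Lemma wedge_coords_det (X w : n.-tuple W) :
  basis_of {:W} X -> wedge X = e -> wedge w = e -> \det (coords_mx X w) = 1.
Proof.
move=> Xb Xe we; have [h hE] := exterior_power_det X.
by rewrite -hE we -Xe hE coords_mx_id ?det1.
Qed.

(** The functional [h] does not vanish at [e], since [h (wedge X) = 1] and [e] spans [L]. A tuple of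
    determinant [h e] then has wedge exactly [e]. *)
Lemma exists_wedge_basis (n_gt0 : (0 < n)%N) (hW : \dim {:W} = n) :
  exists2 w : n.-tuple W, basis_of {:W} w & wedge w = e.
Proof.
have [X Xb] : exists X : n.-tuple W, basis_of {:W} X.
  by case: n / hW; exists (vbasis {:W}); apply: vbasisP.
have [h hE] := exterior_power_det X.
have eE x : exists c, x = c *: e.
  have: x \in <<[:: e]>>%VS by rewrite (span_basis he) memvf.
  by rewrite span_seq1 => /vlineP[c ->]; exists c.
have he_nz : h e != 0.
  apply: contra_neq (oner_neq0 k) => he0.
  rewrite -(det1 k n) -(coords_mx_id Xb) -hE; have [c ->] := eE (wedge X).
  by rewrite linearZ /= he0 scaler0.
(* Positivity of [n] provides a basis vector to scale by [h e]. *)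
have [t tE] : exists t, \det (coords_mx X t) = h e.
  case: n n_gt0 X Xb {hE} => // m _ X Xb.
  have [t tE] := coords_mx_surj Xb (diag_mx (one_tail m (h e))).
  by exists t; rewrite tE det_diag prod_one_tail.
exists t; first by apply: (coords_mx_basis Xb); rewrite tE.
have [c tc] := eE (wedge t); rewrite tc.
suff -> : c = 1 by rewrite scale1r.
by apply: (mulIf he_nz); rewrite mul1r -[RHS]tE -hE tc linearZ.
Qed.

End ExteriorTop.

(** * Bases under extension of scalars *)

Section ScalarExtension.

Variables (k K : fieldType) (iota : {rmorphism k -> K}).
Variables (W : vectType k) (WK : vectType K).
Variable b : {linear W -> WK | iota \; *:%R}.
Hypothesis hb : extension_of_scalars b.
Variables (n : nat) (w : n.-tuple W).
Hypothesis wb : basis_of {:W} w.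

(** The coordinates along [w] extend to a linear map [hK] on [WK], dual to the vectors
    [b (tnth w i)]; this gives freeness. The reconstruction [r] from these coordinates is the
    identity; this gives spanning. *)
Lemma scalar_extension_basis : basis_of {:WK} (map_tuple b w).
Proof.
pose h u : 'rV[K]_n := \row_i iota (coord w i u).
have h_lin : linear_for (iota \; *:%R) h.
  by move=> c u v; apply/rowP => i; rewrite !mxE linearP rmorphD rmorphM.
pose H : {linear W -> 'rV[K]_n | iota \; *:%R} :=
  HB.pack h (GRing.isLinear.Build k W 'rV[K]_n (iota \; *:%R) h h_lin).
have [hK hKE _] := hb H.
have hK_w i : hK (b (tnth w i)) = delta_mx 0 i.
  rewrite hKE; apply/rowP => j.
  by rewrite !mxE coord_tnth_id //= eq_sym rmorph_nat.
pose r x : WK := \sum_i hK x 0 i *: b (tnth w i).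
have r_lin : linear r.
  move=> c u v; rewrite /r scaler_sumr -big_split; apply: eq_bigr => i _ /=.
  by rewrite linearP !mxE scalerDl scalerA.
pose R : {linear WK -> WK} :=
  HB.pack r (GRing.isLinear.Build K WK WK *:%R r r_lin).
have [g _ g_uniq] := hb b.
(* The identity and [R] both extend [b], so uniqueness identifies them. *)
have rK x : x = r x.
  rewrite -[LHS]/(idfun x) (g_uniq idfun) // -(g_uniq R) // => u /=.
  rewrite [u in RHS](coord_tnth wb) linear_sum /r; apply: eq_bigr => i _.
  by rewrite linearZ hKE mxE.
have wK (i : 'I_n) : (map_tuple b w)`_i = b (tnth w i).
  by rewrite -tnth_nth tnth_map.
rewrite basisEdim; apply/andP; split.
  apply/subvP => x _; rewrite [x]rK; apply: memv_suml => i _.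
  by rewrite rpredZ // -tnth_map memv_span // mem_tnth.
have /eqnP <- : free (map_tuple b w).
  apply/freeP => c c0 i; have /(congr1 hK)/rowP/(_ i) := c0.
  rewrite linear0 linear_sum summxE mxE => <-; rewrite (bigD1 i) //=.
  rewrite linearZ wK hK_w !mxE !eqxx mulr1 big1 ?addr0 // => l li.
  by rewrite linearZ wK hK_w !mxE eqxx eq_sym (negPf li) mulr0.
by rewrite dimvS ?subvf.
Qed.

Lemma scalar_extension_coords (t : n.-tuple W) :
  coords_mx (map_tuple b w) (map_tuple b t) = map_mx iota (coords_mx w t).
Proof.
have Xb := scalar_extension_basis; apply/matrixP => i j.
have bw l : coord (map_tuple b w) j (b (tnth w l)) = (l == j)%:R.
  by rewrite -(coord_tnth_id Xb) tnth_map.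
rewrite !mxE tnth_map {1}[tnth t i](coord_tnth wb) !linear_sum (bigD1 j) //=.
rewrite !linearZ /= bw eqxx mulr1 big1 ?addr0 // => l lj.
by rewrite !linearZ /= bw (negPf lj) mulr0.
Qed.

End ScalarExtension.

(* The ring R is kept abstract because unifying the matrix structures over
   {mpoly K[2]} is prohibitively slow. *)
Definition lin_pencil (R : comNzRingType) n (x y : R) (a b : 'M[R]_n) : 'M[R]_n :=
  \matrix_(i, l) (x * a i l - y * b i l).

Lemma disc_lin_pencil_congr (K R : comNzRingType) (phi : {rmorphism K -> R}) n
    (g a b : 'M[K]_n) (x y : R) : \det g = 1 ->
  disc_mx
    (lin_pencil x y (map_mx phi (g *m a *m g^T)) (map_mx phi (g *m b *m g^T))) =
  disc_mx (lin_pencil x y (map_mx phi a) (map_mx phi b)).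
Proof.
have pencilE (c e : 'M[R]_n) : lin_pencil x y c e = x *: c - y *: e.
  by apply/matrixP => i l; rewrite !mxE.
move=> det_g; pose c := map_mx phi g; rewrite /disc_mx !pencilE.
congr (_ * _).
transitivity (\det (c *m (x *: map_mx phi a - y *: map_mx phi b) *m c^T)).
  by rewrite mulmxBr mulmxBl -!scalemxAr -!scalemxAl !map_mxM map_trmx.
by rewrite !det_mulmx det_tr det_map_mx det_g rmorph1 mulr1 mul1r.
Qed.

(** * The discriminant of a pencil as a binary form *)

Section PencilDiscriminant.

Variables (K : fieldType) (n : nat).
Implicit Types (a b g : 'M[K]_n).

Definition pencil_mx a b : 'M[{mpoly K[2]}]_n :=
  \matrix_(i, l) (a i l *: bvarx K - b i l *: bvary K).

Lemma pencil_mxE a b :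
  pencil_mx a b =
  lin_pencil (bvarx K) (bvary K) (map_mx (@mpolyC 2 K) a) (map_mx (@mpolyC 2 K) b).
Proof.
by apply/matrixP => i l; rewrite !mxE -!mul_mpolyC ![_%:MP * _]mulrC.
Qed.

Lemma pencil_disc_congr g a b : \det g = 1 ->
  disc_mx (pencil_mx (g *m a *m g^T) (g *m b *m g^T)) = disc_mx (pencil_mx a b).
Proof.
move=> det_g; rewrite !pencil_mxE.
exact: (disc_lin_pencil_congr (@mpolyC 2 K) _ _ _ _ det_g).
Qed.

Lemma pencil_disc_eval a b (x y : K) :
  (disc_mx (pencil_mx a b)).@[fun i => if i == ord0 then x else y] =
  (-1) ^+ (n * n.-1)./2 * \det (x *: a - y *: b).
Proof.
rewrite /disc_mx rmorphM rmorph_sign /= -det_map_mx; congr (_ * \det _).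
apply/matrixP => i l; rewrite !mxE /= mevalB !mevalZ !mevalXU /=.
by rewrite mulrC [b i l * _]mulrC.
Qed.

End PencilDiscriminant.

Lemma normal_form_disc (K : fieldType) n (d : K) (lam : 'I_n.+1 -> K) :
  disc_mx (pencil_mx (diag_mx (one_tail n d)) (weighted_diag d lam)) =
  ((-1) ^+ (n.+1 * n)./2 * d) *: \prod_i (bvarx K - lam i *: bvary K).
Proof.
have -> : pencil_mx (diag_mx (one_tail n d)) (weighted_diag d lam) =
    diag_mx (\row_i (one_tail n d 0 i *: (bvarx K - lam i *: bvary K))).
  apply/matrixP => i l; rewrite !mxE; case: (eqVneq i l) => [->|_].
    by rewrite !mulr1n scalerBr scalerA [lam l * _]mulrC.
  by rewrite !mulr0n !scale0r subrr.
rewrite /disc_mx det_diag (eq_bigr _ (fun i _ => mxE _ _ _ _)) scaler_prod.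
rewrite prod_one_tail -scalerA -[in RHS]signr_odd -[in LHS]signr_odd /=.
by case: odd; rewrite ?expr1 ?expr0 ?mulN1r ?scaleN1r ?mul1r ?scale1r.
Qed.

Lemma pencil_det_polynomial (K : fieldType) (W : vectType K) n (X : n.-tuple W)
    (x y c : K) :
  polynomial_function (fun v : bilin W * bilin W =>
    \det (x *: gram X v.1 - y *: gram X v.2) - c).
Proof.
(* The variables are the entries of both Gram matrices; the boolean selects the first or the second
   form. *)
pose ev (q : bool * 'I_n * 'I_n) (v : bilin W * bilin W) : K^o :=
  (if q.1.1 then v.1 else v.2) (tnth X q.1.2) (tnth X q.2).
have /fin_all_exists[l lE] (i : 'I_#|{: bool * 'I_n * 'I_n}|) :
    exists F : 'Hom((bilin W * bilin W)%type, K^o), F =1 ev (enum_val i).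
  apply: linear_lfun => a u v; rewrite /ev.
  by case: (enum_val i).1.1; rewrite /= !add_lfunE !scale_lfunE.
pose var q : {mpoly K[#|{: bool * 'I_n * 'I_n}|]} := 'X_(enum_rank q).
exists _, l, (\det (\matrix_(i < n, j < n)
   (x *: var (true, i, j) - y *: var (false, i, j))) - c%:MP) => v.
rewrite mevalB mevalC -det_map_mx; congr (\det _ - _).
apply/matrixP => i j; rewrite !mxE /= mevalB !mevalZ !mevalXU !lE.
by rewrite /ev !enum_rankK.
Qed.

(** * Stabilizers of the translates of the normal form *)

Section Stabilizer.

Variables (K : fieldType) (two_nz : 2%:R != 0 :> K).
Variables (n : nat) (d : K) (lam : 'I_n.+1 -> K) (g : 'M[K]_n.+1).
Hypotheses (d_nz : d != 0) (lam_inj : injective lam) (det_g : \det g = 1).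

Let a := g *m diag_mx (one_tail n d) *m g^T.
Let b := g *m weighted_diag d lam *m g^T.

Definition stab_mx (x : 'rV['F_2]_n) := g *m diag_mx (sign_row K x) *m invmx g.

Let g_unit : g \in unitmx. Proof. by rewrite unitmxE det_g unitr1. Qed.

Lemma stab_mx0 : stab_mx 0 = 1%:M.
Proof.
rewrite /stab_mx; have -> : sign_row K (0 : 'rV['F_2]_n) = const_mx 1.
  apply/rowP => i; rewrite [RHS]mxE; apply: (mulIf (x := sign_row K 0 0 i)).
    by rewrite -sqrf_eq0 sign_row_sqr oner_neq0.
  by rewrite -sign_rowD addr0 mul1r.
by rewrite diag_const_mx mulmx1 mulmxV.
Qed.

Lemma stab_mxD x y : stab_mx (x + y) = stab_mx x *m stab_mx y.
Proof.
rewrite /stab_mx !mulmxA mulmxKV // -[g *m _ *m diag_mx _]mulmxA mulmx_diag.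
by congr (g *m diag_mx _ *m _); apply/rowP => i; rewrite [RHS]mxE sign_rowD.
Qed.

Lemma stab_mx_inj : injective stab_mx.
Proof.
move=> x y /(can_inj (mulmxKV g_unit))/(can_inj (mulKmx g_unit)) xy.
apply: (sign_row_inj two_nz); apply/rowP => i.
by move/matrixP/(_ i i): xy; rewrite [LHS]mxE [RHS]mxE eqxx !mulr1n.
Qed.

(** Conjugation by [g] reduces to the stabilizer of the normal form, where [s] is a diagonal of
    signs; determinant 1 means that their product is 1. *)
Lemma stab_mxP m :
  [/\ \det m = 1, m *m a *m m^T = a & m *m b *m m^T = b] <->
  exists x, stab_mx x = m.
Proof.
pose s := invmx g *m m *m g.
have mE : m = g *m s *m invmx g by rewrite /s !mulmxA mulmxV // mul1mx mulmxK.
have congr_s c : m *m (g *m c *m g^T) *m m^T = g *m (s *m c *m s^T) *m g^T.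
  rewrite /s !trmx_mul trmx_inv !mulmxA mulmxV // mul1mx.
  by rewrite mulmxKV ?unitmx_tr.
have congr_inj : injective (fun c => g *m c *m g^T).
  move=> c1 c2 /(can_inj (mulmxK _)); rewrite unitmx_tr => /(_ g_unit).
  exact: can_inj (mulKmx g_unit) _ _.
split=> [[det_m ma mb]|[x xm]].
  rewrite /a congr_s in ma; rewrite /b congr_s in mb.
  have [t st t2] := normal_form_stabilizer d_nz lam_inj (congr_inj _ _ ma)
    (congr_inj _ _ mb).
  have [|x xt] := sign_row_surj two_nz t2.
    rewrite -det_diag -st /s !det_mulmx det_m mulr1 -det_mulmx mulVmx //.
    by rewrite det1.
  by exists x; rewrite mE st -xt.
have sx : s = diag_mx (sign_row K x).
  by rewrite /s -xm /stab_mx !mulmxA mulVmx // mul1mx mulmxKV.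
have s_diag c : s *m diag_mx c *m s^T = diag_mx c.
  rewrite sx tr_diag_mx !mulmx_diag; congr diag_mx; apply/rowP => i.
  by rewrite [LHS]mxE [in LHS]mxE mulrAC -expr2 sign_row_sqr mul1r.
split; last 2 first.
- by rewrite /a congr_s s_diag.
- by rewrite /b congr_s s_diag.
rewrite mE sx !det_mulmx det_diag prod_sign_row mulr1 -det_mulmx mulmxV //.
by rewrite det1.
Qed.

End Stabilizer.

Lemma abelem_rowF2 n : (2.-abelem [set: 'rV['F_2]_n])%g.
Proof.
rewrite abelemE //; apply/andP; split.
  by apply/centsP => x _ y _; apply: addrC.
apply/exponentP => x _; apply/rowP => i; rewrite FinRing.zmodXgE mulr2n !mxE.
by apply/val_inj; case: (x 0 i) => -[|[]].
Qed.

(** One basis suffices to test the invariant form: two bases with wedge [e] differ by a matrix of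
    determinant 1, which preserves the discriminant of the pencil. *)
Lemma has_invariant_formP (k K : fieldType) (iota : {rmorphism k -> K})
    (n : nat) (W L : vectType k) (wedge : n.-tuple W -> L) (e : L)
    (WK : vectType K) (b : {linear W -> WK | iota \; *:%R}) (w : n.-tuple W)
    (v : bilin WK * bilin WK) (F : {mpoly K[2]}) (X := map_tuple b w) :
    exterior_power wedge -> extension_of_scalars b ->
    basis_of {:W} w -> wedge w = e ->
  has_invariant_form wedge e b v F <->
  F = disc_mx (pencil_mx (gram X v.1) (gram X v.2)).
Proof.
move=> hL hb wb we.
have pencil_gram (t : n.-tuple W) :
    \matrix_(i < n, l < n)
      ((v.1 (b (tnth t i)) (b (tnth t l)) : K) *: bvarx K
       - (v.2 (b (tnth t i)) (b (tnth t l)) : K) *: bvary K) =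
    pencil_mx (gram (map_tuple b t) v.1) (gram (map_tuple b t) v.2).
  by apply/matrixP => i l; rewrite !mxE !tnth_map.
split=> [/(_ w wb we) ->|-> t tb te]; first by rewrite pencil_gram.
have Xb : basis_of {:WK} X by apply: scalar_extension_basis.
have det_t : \det (coords_mx X (map_tuple b t)) = 1.
  rewrite scalar_extension_coords // det_map_mx.
  by rewrite (wedge_coords_det hL wb we te) rmorph1.
by rewrite pencil_gram !(gram_coords Xb (map_tuple b t)) pencil_disc_congr.
Qed.

(** * Existence, uniqueness, closedness and stabilizers of the orbit *)

Theorem theorem4p1
  (k : fieldType) (hk : 2%N \notin [pchar k])
  (ks : fieldType) (iota : {rmorphism k -> ks}) (hks : separable_closure iota)
  (kbar : closedFieldType) (j : {rmorphism ks -> kbar})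
  (hkbar : algebraic_closure j)
  (n : nat) (hn : (0 < n)%N)
  (W : vectType k) (hW : \dim {:W} = n)
  (L : vectType k) (wedge : n.-tuple W -> L) (hL : exterior_power wedge)
  (e : L) (he : basis_of {:L} [:: e])
  (Ws : vectType ks) (b : {linear W -> Ws | iota \; *:%R})
  (hWs : extension_of_scalars b)
  (f : 'I_n.+1 -> ks) (hf0 : f ord0 != 0)
  (D : kbar) (hD : is_Delta j f D) (hD0 : D != 0) :
  exists v0 : bilin Ws * bilin Ws,
    [/\ inV v0 /\ has_invariant_form wedge e b v0 (binary_form f),
        forall v : bilin Ws * bilin Ws, inV v ->
          has_invariant_form wedge e b v (binary_form f) -> SL_orbit v0 v,
        zariski_closed_in (@inV ks Ws) (SL_orbit v0) &
        forall v : bilin Ws * bilin Ws, SL_orbit v0 v ->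
          elementary_abelian_of_order 2 (2 ^ n.-1) (SL_stabilizer v)].
Proof.
have two_nz : 2%:R != 0 :> ks.
  by move: hk; rewrite inE /= -(fmorph_eq0 iota) rmorph_nat.
have [_ sepK] := hks; have sqrtK := sepclosed_sqrt sepK two_nz.
have [lam lam_inj fE] := binary_form_split sepK hf0 hD hD0.
have [w wb we] := exists_wedge_basis hL he hn hW.
pose X := map_tuple b w.
have Xb : basis_of {:Ws} X by apply: scalar_extension_basis.
have formP v : has_invariant_form wedge e b v (binary_form f) <->
    binary_form f = disc_mx (pencil_mx (gram X v.1) (gram X v.2)).
  exact: has_invariant_formP.
case: n hn {hW} wedge hL f hf0 hD lam lam_inj fE w wb we X Xb formP => // m _.
move=> wedge hL f hf0 _ lam lam_inj fE w wb we X Xb formP.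
(* The coefficient of [x^n] in [disc(xA - yB)] is [sg * det A], and [sg] is its own inverse, so [d]
   is the determinant forced on [A]. *)
pose sg : ks := (-1) ^+ (m.+1 * m)./2; pose d := sg * f ord0.
have sgsg : sg * sg = 1 by rewrite -expr2 sqrr_sign.
have sgd : sg * d = f ord0 by rewrite mulrA sgsg mul1r.
have d_nz : d != 0 by rewrite mulf_neq0 // signr_eq0.
have [A0 A0E] := gram_surj Xb (diag_mx (one_tail m d)).
have [B0 B0E] := gram_surj Xb (weighted_diag d lam).
have orbitP v : SL_orbit (A0, B0) v <-> exists g : 'M_m.+1, [/\ \det g = 1,
    gram X v.1 = g *m diag_mx (one_tail m d) *m g^T
  & gram X v.2 = g *m weighted_diag d lam *m g^T].
  split=> [[g /(inSL_endmx _ Xb) g1 []]|].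
    move=> /(is_act_formP Xb) gA /(is_act_formP Xb) gB.
    by exists (endmx X g); rewrite gA gB /= A0E B0E.
  move=> [g [g1 gA gB]]; have [h hE] := endmx_surj Xb g; exists h.
    by apply/(inSL_endmx _ Xb); rewrite hE.
  by split; apply/(is_act_formP Xb); rewrite /= hE ?A0E ?B0E.
have orbit_in v : inV v -> \det (gram X v.1) = d ->
    (forall i, \det (lam i *: gram X v.1 - gram X v.2) = 0) ->
    SL_orbit (A0, B0) v.
  move=> [/(Sym2_gram Xb) sA /(Sym2_gram Xb) sB] dA dAB; apply/orbitP.
  by rewrite -dA; apply: symmetric_pencil_normal_form; rewrite ?dA.
have disc_v0 : binary_form f = disc_mx (pencil_mx (gram X A0) (gram X B0)).
  by rewrite A0E B0E normal_form_disc -/sg sgd.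
have orbit_form v : SL_orbit (A0, B0) v ->
    has_invariant_form wedge e b v (binary_form f).
  case/orbitP => g [g1 gA gB]; apply/formP.
  by rewrite gA gB (pencil_disc_congr _ _ g1) -A0E -B0E.
have orbit_V v : SL_orbit (A0, B0) v -> inV v.
  case/orbitP => g [g1 gA gB]; split; apply/(Sym2_gram Xb).
    by rewrite gA !trmx_mul trmxK tr_diag_mx mulmxA.
  by rewrite gB !trmx_mul trmxK tr_diag_mx mulmxA.
have form_det v : has_invariant_form wedge e b v (binary_form f) ->
    \det (gram X v.1) = d /\
    forall i, \det (lam i *: gram X v.1 - gram X v.2) = 0.
  move/formP => fv.
  (* At [(1, 0)] this identity yields [det A = d]; at [(lam i, 1)] the factor of index [i]
     vanishes. *)
  have ev x y : sg * \det (x *: gram X v.1 - y *: gram X v.2) =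
      f ord0 * \prod_i (x - lam i * y).
    rewrite -pencil_disc_eval -fv fE mevalZ rmorph_prod; congr (_ * _).
    by apply: eq_bigr => i _; rewrite /= mevalB mevalZ !mevalXU.
  split.
    move: (ev 1 0); rewrite scale1r scale0r subr0 big1 => [|i _]; last first.
      by rewrite mulr0 subr0.
    by rewrite mulr1 /d => <-; rewrite mulrA sgsg mul1r.
  move=> i; move/eqP: (ev (lam i) 1); rewrite scale1r (bigD1 i) //=.
  rewrite mulr1 subrr mul0r mulr0 mulf_eq0 signr_eq0 => /eqP //.
have orbit_v0 : SL_orbit (A0, B0) (A0, B0).
  by apply/orbitP; exists 1%:M; rewrite det1 trmx1 !mulmx1 !mul1mx /= A0E B0E.
exists (A0, B0); split.
- by split; [apply: orbit_V | apply: orbit_form].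
- by move=> v vV /form_det[]; apply: orbit_in.
(* The equations are [det A = d] and [det (lam_i A - B) = 0]; the coefficients 1 and 0 and the
   constant 0 put them in the shape of [pencil_det_polynomial]. *)
- exists (fun h =>
    h = (fun v => \det (1 *: gram X v.1 - 0 *: gram X v.2) - d) \/
    exists i, h = (fun v => \det (lam i *: gram X v.1 - 1 *: gram X v.2) - 0)).
  split=> [h [->|[i ->]]|v]; try exact: pencil_det_polynomial.
  split=> [ov|[vV zero]].
    split; first exact: orbit_V.
    have [dA dAB] := form_det _ (orbit_form _ ov).
    move=> h [->|[i ->]]; first by rewrite scale1r scale0r subr0 dA subrr.
    by rewrite scale1r dAB subrr.
  apply: orbit_in => // [|i].
    apply/eqP; rewrite -subr_eq0; apply/eqP.
    by rewrite -[RHS](zero _ (or_introl erefl)) scale1r scale0r subr0.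
  by rewrite -[RHS](zero _ (or_intror (ex_intro _ i erefl))) scale1r subr0.
move=> v /orbitP[g [g1 gA gB]].
exists _, [set: 'rV['F_2]_m]%G; split; last first.
- by rewrite cardsT card_mx card_Fp ?mul1n.
- exact: abelem_rowF2.
have [phi phiE] : exists phi : 'rV['F_2]_m -> 'End(Ws),
    forall x, endmx X (phi x) = stab_mx g x.
  exact: (fin_all_exists (fun x => endmx_surj Xb (stab_mx g x))).
have phi_inj := endmx_inj Xb.
exists phi; split=> [x y _ _ /(congr1 (endmx X))||x y _ _|h].
- rewrite !phiE; exact: stab_mx_inj.
- by apply: phi_inj; rewrite phiE endmx1 // stab_mx0.
(* The reversal by [endmx] is absorbed by commutativity of the group of rows over ['F_2]. *)
- by apply: phi_inj; rewrite endmx_comp // !phiE -stab_mxD // addrC.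
have stabP := stab_mxP two_nz d_nz lam_inj g1 (endmx X h).
split=> [[/(inSL_endmx _ Xb) h1 []]|].
  move=> /(is_act_formP Xb) hA /(is_act_formP Xb) hB.
  case: (iffLR stabP) => [|x xh]; first by rewrite -gA -gB.
  by exists x; rewrite ?inE //; apply: phi_inj; rewrite phiE.
case=> x _ xh; case: (iffRL stabP); first by exists x; rewrite -xh phiE.
rewrite -gA -gB => h1 hA hB; split; first exact/(inSL_endmx _ Xb).
by split; apply/(is_act_formP Xb).
Qed.
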